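(* Assume (SH). Let $x\in\operatorname{dom}f$ and let $0<\rho_t\le1$, $t\in T$, satisfy $\inf_{t\in T}\rho_tf_t(x)>-\infty$. Then \[ \partial f(x)=\bigcap_{\varepsilon>0}\overline{\operatorname{co}}\Big(\Big(\bigcup_{t\in T(x)}\partial_\varepsilon f_t(x)\Big)+\Big(\bigcup_{t\in T\setminus T(x)}\{0,\varepsilon\}\,\partial_\varepsilon(\rho_tf_t)(x)\Big)\Big), \] with the convention that the second union equals $\{\theta\}$ when $T(x)=T$.
   Context: $X$ is a real separated locally convex space with dual $X^*$ carrying the weak$^*$ topology; $\theta$ is the zero of $X^*$. $T$ is a nonempty index set, $\{f_t: t\in T\}$ are proper convex lsc functions $X\to\mathbb{R}\cup\{+\infty\}$, $f:=\sup_{t\in T}f_t$. $T(x):=\{t\in T: f_t(x)=f(x)\}$. $\partial_\varepsilon g(x)=\{x^*:\ g(y)\ge g(x)+\langle x^*,y-x\rangle-\varepsilon\ \forall y\}$ if $g(x)\in\mathbb{R}$, $\varepsilon\ge0$ (empty otherwise), $\partial=\partial_0$. For $\Lambda\subset\mathbb{R}$ and a set $A$, $\Lambda A=\{\lambda a:\lambda\in\Lambda,a\in A\}$; $+$ is the Minkowski sum. $\overline{\operatorname{co}}$ is the weak$^*$-closed convex hull. (SH): $T$ is compact Hausdorff and $t\mapsto f_t(z)$ is upper semicontinuous on $T$ for each $z\in X$. *)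

(* Defs.v *)
From HB Require Import structures.
From mathcomp Require Import all_boot all_order all_algebra.
From mathcomp Require Import all_classical all_reals all_analysis.
Set Implicit Arguments. Unset Strict Implicit. Unset Printing Implicit Defensive.
Import Order.TTheory GRing.Theory Num.Theory.
Local Open Scope classical_set_scope.
Local Open Scope ring_scope.

Section defs.
Context {R : realType} {X : tvsType R}.

Definition dual : set (X -> R) :=
  [set xs | (forall (a : R) (u v : X), xs (a *: u + v) = a * xs u + xs v)
            /\ continuous (xs : X -> R^o)].

Definition theta : X -> R := fun _ => 0.

(* Closure of A (a set of functionals) for the weak* topology, i.e. the
   topology of pointwise convergence on X: basic neighbourhoods of xs are
   given by finitely many points of X and a radius eps > 0. *)
Definition wstar_closure (A : set (X -> R)) : set (X -> R) :=
  [set xs | forall (s : seq X) (eps : R), 0 < eps ->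
     exists2 a, A a & forall z, z \in s -> `|a z - xs z| < eps].

Definition wstar_closed (C : set (X -> R)) :=
  forall xs, dual xs -> wstar_closure C xs -> C xs.

Definition convex_fset (C : set (X -> R)) :=
  forall a b (l : R), C a -> C b -> 0 <= l <= 1 ->
    C (fun z => (1 - l) * a z + l * b z).

Definition wstar_clconv (A : set (X -> R)) : set (X -> R) :=
  [set xs | forall C, C `<=` dual -> convex_fset C -> wstar_closed C ->
            A `<=` C -> C xs].

Definition fun_msum (A B : set (X -> R)) : set (X -> R) :=
  [set xs | exists a, exists b, [/\ A a, B b & xs = (fun z => a z + b z)]].
Definition fun_mscale (L : set R) (A : set (X -> R)) : set (X -> R) :=
  [set xs | exists l, exists a, [/\ L l, A a & xs = (fun z => l * a z)]].

Local Open Scope ereal_scope.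

(* convexity for functions X -> R \cup {+oo} *)
Definition econvex (g : X -> \bar R) :=
  forall (u v : X) (l : R), (0 <= l <= 1)%R ->
    g ((1 - l) *: u + l *: v)%R <= ((1 - l)%:E * g u + l%:E * g v).

Definition proper_fun (g : X -> \bar R) :=
  (forall u, g u != -oo) /\ exists u, g u < +oo.

Definition eps_subdiff (g : X -> \bar R) (x : X) (eps : R) : set (X -> R) :=
  [set xs | [/\ dual xs, g x \is a fin_num &
     forall y, g x + (xs (y - x))%:E - eps%:E <= g y]].

Definition subdiff (g : X -> \bar R) (x : X) := eps_subdiff g x 0.

End defs.

Definition upper_semicontinuous {T : topologicalType} {R : realType}
  (g : T -> \bar R) :=
  forall t (a : R), (g t < a%:E)%E -> exists2 V, nbhs t V & forall s, V s -> (g s < a%:E)%E.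

Definition supf {T : Type} {R : realType} {X : Type} (ft : T -> X -> \bar R)
  : X -> \bar R := fun z => ereal_sup [set ft t z | t in [set: T]].

Definition active {T : Type} {R : realType} {X : Type} (ft : T -> X -> \bar R)
  (x : X) : set T := [set t | ft t x = supf ft x].

(* Main.v *)
Require Import Defs.
From HB Require Import structures.
From mathcomp Require Import all_boot all_order all_algebra.
From mathcomp Require Import all_classical all_reals all_analysis.
From mathcomp Require Import ring lra.
Import Order.TTheory GRing.Theory Num.Theory.
Import numFieldNormedType.Exports.
Local Open Scope classical_set_scope.
Local Open Scope ring_scope.

(* For the inclusion of the subdifferential, let a functional xs lie outside
   the closed convex hull and separate it by a direction z: the generators are
   at most xs z - d at z. If t0 is active, eps-subgradients of f_t0 being
   bounded by xs z - d at z yields r > 0 with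
   f_t0 (x + r z) < f x + r (xs z - d / 2) - eps. If t0 is inactive,
   the generators only give some r > 0 with f_t0 (x + r z) finite, which is
   enough since f_t0 x < f x. In both cases upper semicontinuity in t and
   convexity along the ray give f_t (x + s z) <= f x + s (xs z - d / 2) for all
   t near t0 and all small s > 0; by compactness of T this holds for f itself,
   and xs is not a subgradient of f at x. Conversely, at y - x every generator
   is at most f y - f x + eps (1 + |f y| + |M| + eps), and eps tends to 0. *)

(** * Convex cones, linear forms and the algebraic Hahn-Banach theorem *)

Definition convex_cone {R : realType} {V : lmodType R} (K : set (V * R)) :=
  forall w v t s k l, K (w, t) -> K (v, s) -> 0 <= k -> 0 <= l ->
    K (k *: w + l *: v, k * t + l * s).

(** The algebraic half of [dual], over any module so that it also applies to row vectors. *)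
Definition is_linear {R : realType} {V : lmodType R} (a : V -> R) :=
  forall c u v, a (c *: u + v) = c * a u + a v.

Section is_linear_theory.
Context {R : realType} {V : lmodType R} {a : V -> R} (la : is_linear a).

Lemma is_linear0 : a 0 = 0.
Proof. by have := la (-1) 0 0; rewrite scaler0 addr0 => H; lra. Qed.

Lemma is_linearD u v : a (u + v) = a u + a v.
Proof. by have := la 1 u v; rewrite scale1r mul1r. Qed.

Lemma is_linearZ c u : a (c *: u) = c * a u.
Proof. by have := la c u 0; rewrite !addr0 is_linear0 addr0. Qed.

Lemma is_linearN u : a (- u) = - a u.
Proof. by rewrite -scaleN1r is_linearZ mulN1r. Qed.

Lemma is_linearB u v : a (u - v) = a u - a v.
Proof. by rewrite is_linearD is_linearN. Qed.

Lemma is_linear_sum n (F : 'I_n -> V) : a (\sum_i F i) = \sum_i a (F i).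
Proof.
elim/big_ind2 : _ => //; first exact: is_linear0.
by move=> _ u _ v <- <-; rewrite is_linearD.
Qed.

End is_linear_theory.

(* Hahn-Banach theorem: the cone plays the role of the epigraph of a sublinear
   function. In a maximal cone above K, both (w, t) and (-w, -t) occur for
   t = inf {s | (w, s) in the cone}, so that the cone is the epigraph of a
   linear form. *)
Lemma linear_below_cone (R : realType) (V : lmodType R) (K : set (V * R)) :
  convex_cone K -> (forall s, K (0, s) -> 0 <= s) ->
  (forall w, exists s, K (w, s)) ->
  exists2 a, is_linear a & forall w s, K (w, s) -> a w <= s.
Proof.
move=> cK K0 Kd.
(* [P] speaks of the union with [K], so that the empty chain in Zorn's lemma satisfies it too. *)
pose P (A : set (V * R)) := convex_cone (K `|` A) /\ forall s, (K `|` A) (0, s) -> 0 <= s.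
have [F FP Ftot|A [[cM M0] Amax]] := @Zorn_bigcup _ P.
  have bigD X : F X -> K `|` X `<=` K `|` \bigcup_(X in F) X.
    by move=> FX y [Ky|Xy]; [left|right; exists X].
  split=> [w v t s k l Kw Kv k0 l0|s].
    case: Kw Kv => [Kw [Kv|[Y FY Yv]]|[X FX Xw] [Kv|[Y FY Yv]]].
    - by left; exact: cK.
    - by apply: (bigD Y FY); apply: (FP Y FY).1 => //; [left|right].
    - by apply: (bigD X FX); apply: (FP X FX).1 => //; [right|left].
    - have [XY|YX] := Ftot _ _ FX FY.
        by apply: (bigD Y FY); apply: (FP Y FY).1 => //; right => //; exact: XY.
      by apply: (bigD X FX); apply: (FP X FX).1 => //; right => //; exact: YX.
  by case=> [/K0//|[X FX Xs]]; apply: (FP X FX).2; right.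
pose M := K `|` A.
have KM : K `<=` M by move=> ? ?; left.
have maxM w t : (forall s, M (- w, s) -> 0 <= s + t) -> M (w, t).
  move=> wt; apply: contrapT => nM.
  (* Adjoining the ray of [(w, t)] to [M] gives a convex cone whose heights over 0 stay nonnegative
     thanks to [wt], so maximality puts [(w, t)] in [M]. *)
  pose N := [set y : V * R | exists v s l, [/\ M (v, s), 0 <= l &
     y = (v + l *: w, s + l * t)]].
  have MN : M `<=` N.
    by move=> [v s] Mv; exists v, s, 0; rewrite scale0r mul0r !addr0.
  have [s0 Ks0] := Kd 0.
  have M00 : M (0, 0).
    have := cM _ _ _ _ 0 0 (KM _ Ks0) (KM _ Ks0) (lexx _) (lexx _).
    by rewrite !scale0r !mul0r !addr0.
  have NE : K `|` N = N.
    by rewrite setUidr// => y /KM /MN.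
  apply: (Amax N).
    split; first by move=> y Ay; apply: MN; right.
    move=> /(_ (w, t)) NA; apply: nM; right; apply: NA.
    by exists 0, 0, 1; rewrite scale1r mul1r !add0r.
  rewrite /P NE; split.
    move=> _ _ _ _ k l [v [s [m [Mv m0 [-> ->]]]]] [v' [s' [m' [Mv' m'0 [-> ->]]]]] k0 l0.
    exists (k *: v + l *: v'), (k * s + l * s'), (k * m + l * m').
    split; [exact: cM|by rewrite addr_ge0 ?mulr_ge0|].
    rewrite !scalerDr !scalerA scalerDl addrACA; congr (_, _); ring.
  move=> s [v [r [l [Mv l0 [v0 ->]]]]].
  have {}v0 : v = - (l *: w) by apply/eqP; rewrite -addr_eq0 -v0.
  have [l00|lneq] := eqVneq l 0.
    by move: Mv; rewrite v0 l00 mul0r addr0 scale0r oppr0; exact: M0.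
  have lgt : 0 < l by rewrite lt_neqAle eq_sym lneq.
  have : M (- w, l^-1 * r).
    have := cM _ _ _ _ l^-1 0 Mv M00; rewrite v0 scaler0 mulr0 !addr0 scalerN.
    by rewrite scalerA mulVf// scale1r; apply=> //; rewrite invr_ge0.
  move=> /wt H; have -> : r + l * t = l * (l^-1 * r + t) by field.
  by rewrite mulr_ge0.
have oppM w s s' : M (w, s) -> M (- w, s') -> 0 <= s + s'.
  move=> Mw Mw'; have := cM _ _ _ _ 1 1 Mw Mw' ler01 ler01.
  by rewrite !scale1r !mul1r subrr; exact: M0.
have graph w : exists t, M (w, t) /\ M (- w, - t).
  pose S := [set s | M (w, s)].
  have [s1 Ks1] := Kd w; have [s2 Ks2] := Kd (- w).
  have lbS s' : M (- w, s') -> lbound S (- s').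
    by move=> Mw' s Ss; have := oppM _ _ _ Ss Mw'; lra.
  have hlb : has_lbound S by exists (- s2); apply: lbS; exact: KM.
  have S0 : S !=set0 by exists s1; exact: KM.
  exists (inf S); split; apply: maxM => s Ms.
    have := lb_le_inf S0 (lbS _ Ms); lra.
  rewrite opprK in Ms; have := ge_inf hlb Ms; lra.
have [a aM] := choice graph.
exists a => [c u v|w s Kw]; last first.
  by have := oppM _ _ _ (KM _ Kw) (aM w).2; lra.
have [Mu Mu'] := aM u; have [Mv Mv'] := aM v; have [Mw Mw'] := aM (c *: u + v).
(* The cone takes only nonnegative coefficients; for negative [c], [- c] multiplies the opposite
   points. *)
have [c0|c0] := leP 0 c.
  have := cM _ _ _ _ c 1 Mu Mv c0 ler01; have := cM _ _ _ _ c 1 Mu' Mv' c0 ler01.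
  rewrite !scale1r scalerN -opprD => H1 H2.
  have := oppM _ _ _ Mw H1; have := oppM _ _ _ H2 Mw'; lra.
have nc0 : 0 <= - c by lra.
have := cM _ _ _ _ (- c) 1 Mu' Mv nc0 ler01; have := cM _ _ _ _ (- c) 1 Mu Mv' nc0 ler01.
rewrite !scale1r scalerN scaleNr opprK -opprD => H1 H2.
have := oppM _ _ _ Mw H1; have := oppM _ _ _ H2 Mw'; lra.
Qed.

(** A form below [D] and at most [b] on [U] is one below the cone generated by [D] and [U] at height
    [b]. Absorption puts a point of this cone over every vector; the last two hypotheses make its
    heights over 0 nonnegative. *)
Lemma linear_sandwich (R : realType) (V : lmodType R) (D : set (V * R))
    (U : set V) (b : R) :
  D !=set0 ->
  (forall w v t s l, D (w, t) -> D (v, s) -> 0 <= l <= 1 ->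
     D ((1 - l) *: w + l *: v, (1 - l) * t + l * s)) ->
  (forall u v l, U u -> U v -> 0 <= l <= 1 -> U ((1 - l) *: u + l *: v)) ->
  (forall w, exists k u, [/\ 0 <= k, U u & w = k *: u]) ->
  0 <= b ->
  (forall u s k, U u -> 0 <= k -> D (- (k *: u), s) -> 0 <= s + k * b) ->
  exists a : V -> R, [/\ is_linear a, forall w s, D (w, s) -> a w <= s &
    forall u, U u -> a u <= b].
Proof.
move=> [[d0 e0] D0] cD cU aU b0 DU.
have [_ [u0 [_ U0 _]]] := aU 0.
pose K := [set y : V * R | exists w s u k l, [/\ D (w, s), U u, 0 <= k, 0 <= l &
   y = (k *: w + l *: u, k * s + l * b)]].
have quot (k l : R) : 0 <= k -> 0 <= l -> 0 < k + l ->
    [/\ 0 <= l / (k + l) <= 1, (k + l) * (1 - l / (k + l)) = k & (k + l) * (l / (k + l)) = l].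
  move=> k0 l0 kl; split; [|by field; rewrite gt_eqF|by field; rewrite gt_eqF].
  by apply/andP; split; [rewrite divr_ge0// ltW|rewrite ler_pdivrMr// mul1r lerDr].
(* An element of [K] uses one point of [D] and one of [U]: convexity merges two points into one, and
   when [k + l = 0] any point will do. *)
have sumU u v k l : U u -> U v -> 0 <= k -> 0 <= l ->
    exists2 y, U y & k *: u + l *: v = (k + l) *: y.
  move=> Uu Uv k0 l0; have [kl|kl] := leP (k + l) 0.
    by exists u => //; (have -> : k = 0 by lra); (have -> : l = 0 by lra); rewrite addr0 !scale0r addr0.
  have [h1 h2 h3] := quot k l k0 l0 kl.
  exists ((1 - l / (k + l)) *: u + l / (k + l) *: v); first exact: cU.
  by rewrite scalerDr !scalerA h2 h3.
have sumD u v s t k l : D (u, s) -> D (v, t) -> 0 <= k -> 0 <= l ->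
    exists y r, [/\ D (y, r), k *: u + l *: v = (k + l) *: y & k * s + l * t = (k + l) * r].
  move=> Uu Uv k0 l0; have [kl|kl] := leP (k + l) 0.
    exists u, s; (have -> : k = 0 by lra); (have -> : l = 0 by lra).
    by rewrite !(addr0, scale0r, mul0r).
  have [h1 h2 h3] := quot k l k0 l0 kl.
  exists ((1 - l / (k + l)) *: u + l / (k + l) *: v),
    ((1 - l / (k + l)) * s + l / (k + l) * t); split; first exact: cD.
    by rewrite scalerDr !scalerA h2 h3.
  by rewrite mulrDr (mulrA _ (1 - _)) h2 (mulrA _ (l / _)) h3.
have [||w|a la aK] := @linear_below_cone R V K.
- move=> _ _ _ _ m n [w [s [u [k [l [Dw Uu k0 l0 [-> ->]]]]]]]
    [w' [s' [u' [k' [l' [Dw' Uu' k'0 l'0 [-> ->]]]]]]] m0 n0.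
  have [y Uy yE] := sumU u u' (m * l) (n * l') Uu Uu' (mulr_ge0 m0 l0) (mulr_ge0 n0 l'0).
  have [x [r [Dx xE rE]]] := sumD w w' s s' (m * k) (n * k') Dw Dw' (mulr_ge0 m0 k0) (mulr_ge0 n0 k'0).
  exists x, r, y, (m * k + n * k'), (m * l + n * l').
  split => //; try by rewrite addr_ge0 ?mulr_ge0.
  congr (_, _); last by rewrite -rE; ring.
  by rewrite -xE -yE !scalerDr !scalerA addrACA.
- move=> _ [w [s [u [k [l [Dw Uu k0 l0 [wE ->]]]]]]].
  have [->|kn0] := eqVneq k 0; first by rewrite mul0r add0r mulr_ge0.
  have kgt : 0 < k by rewrite lt_neqAle eq_sym kn0.
  have {}wE : w = - ((l / k) *: u).
    apply: (scalerI kn0); rewrite scalerN scalerA mulrCA mulfV// mulr1.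
    by apply/eqP; rewrite -addr_eq0 -wE.
  have := DU u s (l / k) Uu (divr_ge0 l0 k0); rewrite -wE => /(_ Dw) H.
  have -> : k * s + l * b = k * (s + l / k * b) by field.
  by rewrite mulr_ge0.
- have [k [u [k0 Uu ->]]] := aU w.
  by exists (0 * e0 + k * b), d0, e0, u, 0, k; split; rewrite // scale0r add0r.
- exists a; split=> // [w s Dw|u Uu]; apply: aK.
    by exists w, s, u0, 1, 0; split; rewrite // scale0r mul0r !addr0 scale1r mul1r.
  by exists d0, e0, u, 0, 1; split; rewrite // scale0r mul0r !add0r scale1r mul1r.
Qed.

(** * Separation in the weak* topology *)

(** Finitely many points witness that [xs] is outside the closure. Evaluation at them reduces the
    claim to separating a convex set of row vectors from an open cube around 0. *)
Lemma wstar_separation {R : realType} {X : tvsType R} {C : set (X -> R)} {xs} :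
  C !=set0 -> C `<=` dual -> convex_fset C -> dual xs -> ~ wstar_closure C xs ->
  exists z d, 0 < d /\ forall a, C a -> a z <= xs z - d.
Proof.
move=> [c0 Cc0] Cd cC [lxs _] /existsNP[s /existsNP[e /not_implyP[e0 nC]]].
pose n := size s.
pose ev (h : X -> R) : 'rV[R]_n := \row_i h s`_i.
(* The height -1 makes the separating form at most -1 on the shifted image of [C], which gives the
   gap [d = 1]. *)
pose D := [set y : 'rV[R]_n * R | exists2 a, C a & y = (ev a - ev xs, - 1)].
pose U := [set v : 'rV[R]_n | forall i, `|v 0 i| < e].
have [||||||phi [lphi Dphi _]] := @linear_sandwich R 'rV[R]_n D U 1.
- by exists (ev c0 - ev xs, -1), c0.
- move=> _ _ _ _ l [a Ca [-> ->]] [b Cb [-> ->]] l01.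
  exists (fun z => (1 - l) * a z + l * b z); first exact: cC.
  congr (_, _); last by ring.
  by apply/rowP => i; rewrite !mxE; ring.
- move=> u v l Uu Uv /andP[l0 l1] i; rewrite !mxE.
  rewrite (le_lt_trans (ler_normD _ _))// !normrM (ger0_norm l0) (@ger0_norm _ (1 - l)) ?subr_ge0//.
  have := Uu i; have := Uv i; set p := `|v 0 i|; set q := `|u 0 i| => pe qe.
  have : l * p <= l * e by rewrite ler_wpM2l// ltW.
  have : (1 - l) * q <= (1 - l) * e by rewrite ler_wpM2l ?subr_ge0// ltW.
  have [->|ln0] := eqVneq l 0; first by lra.
  have : l * p < l * e by rewrite ltr_pM2l// lt_neqAle eq_sym ln0.
  lra.
- move=> w; pose m := \sum_i `|w 0 i|.
  have m0 : 0 <= m by apply: sumr_ge0.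
  (* As [m] bounds every coordinate, dividing by this factor lands strictly inside the cube; the
     [+ 1] also covers [w = 0]. *)
  exists ((m + 1) / e), (((m + 1) / e)^-1 *: w); split.
  + by rewrite divr_ge0 ?ltW//; lra.
  + move=> i; rewrite mxE invf_div normrM ger0_norm; last by rewrite divr_ge0 ?ltW//; lra.
    rewrite mulrAC ltr_pdivrMr; last lra.
    rewrite ltr_pM2l//.
    suff : `|w 0 i| <= m by lra.
    by rewrite /m (bigD1 i)//= lerDl sumr_ge0.
  + by rewrite scalerA mulfV ?scale1r// mulf_neq0 ?invr_neq0// gt_eqF//; lra.
- exact: ler01.
- move=> u t k Uu k0 [a Ca [uE ->]]; rewrite mulr1.
  suff : 1 <= k by lra.
  rewrite leNgt; apply/negP => k1; apply: nC; exists a => // z zs.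
  have iz : (index z s < n)%N by rewrite index_mem.
  have /rowP/(_ (Ordinal iz)) := uE; rewrite !mxE/= nth_index// => <-.
  rewrite normrN normrM ger0_norm//; apply: le_lt_trans (Uu (Ordinal iz)).
  by rewrite ler_piMl// ltW.
(* Evaluation at this point is [phi] composed with [ev] on linear functionals, so [phi] becomes a
   direction in [X]. *)
pose z := \sum_i phi (delta_mx 0 i) *: (s`_(val i) : X).
have zE (h : X -> R) : is_linear h -> h z = phi (ev h).
  move=> lh; rewrite (is_linear_sum lh) [in RHS](row_sum_delta (ev h)) (is_linear_sum lphi).
  by apply: eq_bigr => i _; rewrite (is_linearZ lh) (is_linearZ lphi) mxE mulrC.
exists z, 1; split; first exact: ltr01.
move=> a Ca; have [la _] := Cd _ Ca.
rewrite (zE _ la) (zE _ lxs); have : phi (ev a - ev xs) <= -1 by apply: Dphi; exists a.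
by rewrite (is_linearB lphi); lra.
Qed.

(** * Neighbourhoods of zero and continuity of linear forms *)

Lemma convex_nbhs0 {R : realType} {X : tvsType R} {W : set X} : nbhs 0 W ->
  exists U, [/\ nbhs 0 U, U `<=` W &
    forall u v (l : R), U u -> U v -> 0 <= l <= 1 -> U ((1 - l) *: u + l *: v)].
Proof.
move=> W0; have [B cB [oB Bb]] := @locally_convex R X.
have [U [BU U0] UW] := Bb 0 W W0.
exists U; split => //; first by apply: open_nbhs_nbhs; split => //; exact: oB.
move=> u v l Uu Uv /andP[l0 l1].
have cU := cB U (mem_set BU).
have l01 : Itv.spec (@Itv.num_sem R) (Itv.Real `[0%Z, 1%Z]) (1 - l).
  by apply/and3P; split; rewrite ?num_real//= ?bnd_simp//; lra.
have := cU u v (@Itv.mk _ _ _ _ l01) (mem_set Uu) (mem_set Uv).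
by rewrite inE /conv/= /unstable.onem opprB addrCA subrr addr0.
Qed.

Lemma nbhs0_absorbing (R : realType) (X : tvsType R) (U : set X) (w : X) :
  nbhs 0 U -> exists k u, [/\ 0 <= k :> R, U u & w = k *: u].
Proof.
move=> U0.
have /= := @scale_continuous R X (0, w) U; rewrite scale0r => /(_ U0)[[A B]/= [A0 B0] AB].
have At : \forall t \near (0 : R)^'+, A t by exact: cvg_at_right_filter A0.
have [t [tA t0]] := filter_ex (filterI At (nbhs_right_gt (0 : R))).
exists t^-1, (t *: w); split; first by rewrite invr_ge0 ltW.
  by apply: (AB (t, w)); split => //=; exact: nbhs_singleton.
by rewrite scalerA mulVf ?scale1r// gt_eqF.
Qed.

(** On [k U] and on [- k U], with [k = e / (2 b)], the form is bounded on one side by [e / 2]; both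
    signs are taken since [U] need not be symmetric. *)
Lemma is_linear_continuous {R : realType} {X : tvsType R} {a : X -> R} {U : set X} {b : R} :
  is_linear a -> 0 < b -> nbhs 0 U -> (forall u, U u -> a u <= b) ->
  continuous (a : X -> R^o).
Proof.
move=> la b0 U0 Ub x; apply/(@cvgrPdist_lt R R^o) => e e0.
have k0 : 0 < e / (2 * b) by rewrite divr_gt0// mulr_gt0.
have kn0 : e / (2 * b) != 0 by rewrite gt_eqF.
have nkn0 : - (e / (2 * b)) != 0 by rewrite oppr_eq0.
have := nbhsT x (nbhs0Z kn0 U0).
have := nbhsT x (nbhs0Z nkn0 U0).
apply: filterS2 => _ [_ [u Uu <-] <-] [_ [v Uv <-] /addrI vu].
have E c : e / (2 * b) * c <= e / 2 -> e / (2 * b) * c < e by move=> /le_lt_trans; apply; lra.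
have bd w : U w -> e / (2 * b) * a w < e.
  move=> Uw; apply: E; have -> : e / 2 = e / (2 * b) * b by field; rewrite gt_eqF.
  by rewrite ler_pM2l// Ub.
have := bd _ Uu; have := bd _ Uv.
rewrite -(is_linearZ la) vu -(is_linearZ la) scaleNr (is_linearN la).
rewrite (is_linearD la) (is_linearN la) opprD opprK addrA subrr add0r ltr_norml => h1 h2.
by apply/andP; split; lra.
Qed.

(** * Convex lower semicontinuous functions and their eps-subdifferentials *)

Lemma econvex_le {R : realType} {X : tvsType R} {g : X -> \bar R} {u v p q l} :
  econvex g -> (g u <= p%:E)%E -> (g v <= q%:E)%E -> 0 <= l <= 1 ->
  (g ((1 - l) *: u + l *: v)%R <= ((1 - l) * p + l * q)%:E)%E.
Proof.
move=> cg gu gv l01; apply: (le_trans (cg u v l l01)).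
have /andP[l0 l1] := l01.
by rewrite [leRHS]EFinD !EFinM; apply: leeD; apply: lee_wpmul2l; rewrite // lee_fin ?subr_ge0.
Qed.

(** Near each [r0], a constant strictly between the two sides survives small changes of [r] and [u];
    compactness of the segment makes the neighbourhood of [u] uniform in [r]. *)
Lemma lsc_along_ray {R : realType} {X : tvsType R} {g : X -> \bar R}
    {x z : X} {b al : R} (s : R) :
  lower_semicontinuous g ->
  (forall r, 0 <= r -> ((b + r * al)%:E < g (x + r *: z)%R)%E) ->
  \forall u \near (0 : X), forall r, 0 <= r <= s ->
    ((b + r * al)%:E < g (x + r *: z - u)%R)%E.
Proof.
move=> lsg gt.
have /compact_near_coveringP := @segment_compact R 0 s.
move=> /(_ X (nbhs (0 : X)) (fun u r => 0 <= r -> ((b + r * al)%:E < g (x + r *: z - u)%R)%E) _) H.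
suff : \forall u \near (0 : X), `[0, s] `<=`
    (fun r => 0 <= r -> ((b + r * al)%:E < g (x + r *: z - u)%R)%E).
  apply: filterS => u uP r /andP[r0 rs]; apply: uP => //=.
  by rewrite in_itv/= r0.
apply: H => r0 /=; rewrite in_itv/= => /andP[r00 _].
have [c [cb cg]] : exists c, b + r0 * al < c /\ (c%:E < g (x + r0 *: z)%R)%E.
  have := gt _ r00; case: (g _) => [y| |] //.
    rewrite lte_fin => by_; exists ((b + r0 * al + y) / 2); rewrite lte_fin; lra.
  by move=> _; exists (b + r0 * al + 1); rewrite ltry; split => //; lra.
have [V Vx Vg] := lsg _ _ cg.
have cont : (x + p.1 *: z - p.2) @[p --> (r0, 0 : X)] --> x + r0 *: z - 0.
  have h1 : (p.1 *: z) @[p --> (r0, 0 : X)] --> r0 *: z.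
    apply: (@continuous2_cvg _ R^o X X _ _ (fun p => p.1) (fun=> z) (fun r v => r *: v) r0 z).
    - exact: (@scale_continuous R X (r0, z)).
    - exact: (@cvg_fst R^o).
    - exact: cvg_cst.
  apply: (@continuous2_cvg _ X X X _ _ _ _ (fun u v => u - v)); last exact: cvg_snd.
    exact: (@sub_continuous X (_, _)).
  apply: (@continuous2_cvg _ X X X _ _ _ _ (fun u v => u + v)); last exact: h1.
    exact: (@add_continuous X (_, _)).
  exact: cvg_cst.
have near1 : \forall p \near (r0, 0 : X), V (x + p.1 *: z - p.2).
  by apply: cont; rewrite /= subr0.
have near2 : \forall p \near (r0, 0 : X), b + p.1 * al < c.
  have cl : (b + p.1 * al : R^o) @[p --> (r0, 0 : X)] --> (b + r0 * al : R^o).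
    apply: cvgD; [exact: cvg_cst|apply: cvgM; [|exact: cvg_cst]].
    exact: (@cvg_fst R^o).
  exact: (cl _ (lt_nbhsl cb)).
apply: (@filterS _ (nbhs (r0, 0 : X)) _ _ _ _ (filterI near1 near2)) => p [Vp pc] _.
by apply: lt_trans (Vg _ Vp); rewrite lte_fin.
Qed.

(* The support function of the eps-subdifferential in the direction z is at
   least inf_(r > 0) (g (x + r z) - g x + eps) / r. Otherwise, for a slope m
   between al and al', the graph of r |-> g x - eps + r m over the ray lies
   below the epigraph of g, with a uniform neighbourhood of the ray: by lower
   semicontinuity on a compact piece, and by convexity beyond it. A linear form
   separating the two is an eps-subgradient with a z >= m. *)
Lemma eps_subdiff_slope {R : realType} {X : tvsType R} {g : X -> \bar R}
    {x : X} (z : X) {gx al al' eps : R} :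
  (forall u, g u != -oo%E) -> econvex g -> lower_semicontinuous g ->
  g x = gx%:E -> 0 < eps ->
  (forall a, eps_subdiff g x eps a -> a z <= al) -> al < al' ->
  exists r, 0 < r /\ (g (x + r *: z)%R < (gx + r * al' - eps)%:E)%E.
Proof.
move=> gN cg lsg gxE e0 sub alt; apply: contrapT => /forallNP nr.
have {}nr r : 0 < r -> ((gx + r * al' - eps)%:E <= g (x + r *: z)%R)%E.
  by move=> r0; rewrite leNgt; apply/negP => h; apply: (nr r).
pose m := (al + al') / 2.
have mal' : m < al' by rewrite /m; lra.
have mal : al < m by rewrite /m; lra.
(* At [r = s] the bound [nr] reads [gx + s * m + 1]: there [g] exceeds the line of slope [m] through
   [gx] itself, not only the one lowered by [eps]. *)
pose s := (eps + 1) / (al' - m).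
have s0 : 0 < s by rewrite divr_gt0//; lra.
have sE : s * al' = s * m + eps + 1 by rewrite /s; field; rewrite gt_eqF// subr_gt0.
clearbody s m.
have ray r : 0 <= r -> ((gx - eps + r * m)%:E < g (x + r *: z)%R)%E.
  rewrite le_eqVlt => /predU1P[<-|r0].
    by rewrite scale0r addr0 gxE lte_fin; lra.
  apply: lt_le_trans (nr _ r0); rewrite lte_fin.
  have : r * m < r * al' by rewrite ltr_pM2l.
  lra.
have ns : \forall u \near (0 : X), ((gx + s * m)%:E < g (x + s *: z - u)%R)%E.
  have : ((gx + s * m)%:E < g (x + s *: z)%R)%E.
    by apply: lt_le_trans (nr _ s0); rewrite lte_fin; lra.
  move=> /lsg[V Vx Vg]; have : \forall u \near (0 : X), V (x + s *: z - u).
    have c1 : (x + s *: z - u) @[u --> (0 : X)] --> x + s *: z - 0.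
      apply: (@continuous2_cvg _ X X X _ _ _ _ (fun u v => u - v)); last exact: cvg_id.
        exact: (@sub_continuous X (_, _)).
      exact: cvg_cst.
    by apply: c1; rewrite subr0.
  by apply: filterS => u; exact: Vg.
have [U [U0 UW cU]] := convex_nbhs0 (filterI ns (lsc_along_ray s lsg ray)).
have below u r v : U u -> 0 <= r -> (g (x + r *: z - u)%R <= v%:E)%E -> gx - eps + r * m <= v.
  move=> Uu r0 gv; have [far near] := UW _ Uu; have [rs|sr] := leP r s.
    by rewrite -lee_fin (le_trans _ gv)// ltW// near// r0.
  (* Beyond [s], the point is contracted towards [x] by [s / r], back to parameter [s]; [u] shrinks
     and stays in the convex set [U]. *)
  have rgt : 0 < r by lra.
  have l01 : 0 <= s / r <= 1.
    by apply/andP; split; [rewrite divr_ge0// ltW|rewrite ler_pdivrMr// mul1r ltW].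
  have gx' : (g x <= gx%:E)%E by rewrite gxE.
  have := econvex_le cg gx' gv l01.
  have -> : (1 - s / r) *: x + s / r *: (x + r *: z - u) = x + s *: z - s / r *: u.
    rewrite !scalerBr !scalerDr scalerBl scale1r scalerA -mulrA mulVf ?gt_eqF// mulr1.
    by rewrite !addrA subrK.
  have Ul : U (s / r *: u).
    by have := cU 0 u _ (nbhs_singleton U0) Uu l01; rewrite scaler0 add0r.
  have [/lt_le_trans h _] := UW _ Ul; move=> /h; rewrite lte_fin => hh.
  have : s * m < s / r * (v - gx) by lra.
  rewrite -mulrA ltr_pM2l// mulrC ltr_pdivlMr// => H; lra.
(* Differences between the epigraph of [g] and the half-line of points
   [(x + r z, gx - eps + r m)]. *)
pose D := [set y : X * R | exists w r v, [/\ 0 <= r, (g w <= v%:E)%E &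
   y = (w - x - r *: z, v - gx + eps - r * m)]].
have [||||||a [la aD aU]] := @linear_sandwich R X D U eps.
- by exists (x - x - 0 *: z, gx - gx + eps - 0 * m), x, 0, gx; rewrite gxE.
- move=> _ _ _ _ l [w [r [v [r0 gw [-> ->]]]]] [w' [r' [v' [r'0 gw' [-> ->]]]]] l01.
  exists ((1 - l) *: w + l *: w'), ((1 - l) * r + l * r'), ((1 - l) * v + l * v').
  split; [|exact: econvex_le|].
    by case/andP: l01 => l0 l1; rewrite addr_ge0// mulr_ge0// subr_ge0.
  congr (_, _); last by ring.
  rewrite !scalerBr addrACA [X in X + _]addrACA -!opprD -scalerDl subrK scale1r.
  by rewrite !scalerA -scalerDl.
- exact: cU.
- by move=> w; exact: nbhs0_absorbing.
- exact: ltW.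
- move=> u _ k Uu k0 [w [r [v [r0 gw [uE ->]]]]].
  have wE : w = x + r *: z - k *: u.
    by apply/eqP; rewrite addrC -subr_eq uE opprD addrA.
  rewrite wE in gw; have [k1|k1] := leP k 1.
    have Uku : U (k *: u).
      have := cU 0 u k (nbhs_singleton U0) Uu; rewrite scaler0 add0r; apply.
      by rewrite k0.
    have := below _ _ _ Uku r0 gw.
    have : 0 <= k * eps by rewrite mulr_ge0// ltW.
    lra.
  (* For [k > 1], contraction by [1 / k] towards [x] reduces to [u] in [U]. Scaling back multiplies
     the [eps] of [below] by [k], which the bound [eps] on [U] absorbs. *)
  have kgt : 0 < k by lra.
  have l01 : 0 <= k^-1 <= 1 by rewrite invr_ge0 ltW//= invf_le1// ltW.
  have gx' : (g x <= gx%:E)%E by rewrite gxE.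
  have := econvex_le cg gx' gw l01.
  have -> : (1 - k^-1) *: x + k^-1 *: (x + r *: z - k *: u) = x + (k^-1 * r) *: z - u.
    rewrite !scalerBr !scalerDr scalerBl scale1r !scalerA mulVf ?gt_eqF// scale1r.
    by rewrite !addrA subrK.
  have kr0 : 0 <= k^-1 * r by rewrite mulr_ge0// invr_ge0 ltW.
  move=> /(below _ _ _ Uu kr0) H.
  have : k * (gx - eps + k^-1 * r * m) <= k * ((1 - k^-1) * gx + k^-1 * v) by rewrite ler_pM2l.
  have -> : k * (gx - eps + k^-1 * r * m) = k * gx - k * eps + r * m by field; rewrite gt_eqF.
  have -> : k * ((1 - k^-1) * gx + k^-1 * v) = k * gx - gx + v by field; rewrite gt_eqF.
  lra.
have az : m <= a z.
  rewrite leNgt; apply/negP => azm.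
  (* The point of [D] with [w = x] gives [r * (m - a z) <= eps]; this [r] would make the left side
     [eps + 1]. *)
  pose r := (eps + 1) / (m - a z).
  have r0 : 0 <= r by rewrite divr_ge0//; lra.
  have : a (x - x - r *: z) <= gx - gx + eps - r * m.
    by apply: aD; exists x, r, gx; rewrite gxE.
  rewrite subrr sub0r (is_linearN la) (is_linearZ la).
  have : r * m - r * a z = eps + 1 by rewrite /r; field; rewrite gt_eqF// subr_gt0.
  lra.
suff /sub : eps_subdiff g x eps a by lra.
split; [split=> //; exact: (is_linear_continuous la e0 U0 aU)|by rewrite gxE|].
move=> y; case gy : (g y) => [v| |]; [|by rewrite leey|by have := gN y; rewrite gy].
have : a (y - x - 0 *: z) <= v - gx + eps - 0 * m.
  by apply: aD; exists y, 0, v; rewrite gy.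
by rewrite scale0r subr0 gxE lee_fin; lra.
Qed.

(** If the set were empty, [eps_subdiff_slope] would apply vacuously in direction 0 with slopes -1
    and 0, giving [g x < g x - eps]. *)
Lemma eps_subdiff_nonempty {R : realType} {X : tvsType R} {g : X -> \bar R}
    {x : X} {gx eps : R} :
  (forall u, g u != -oo%E) -> econvex g -> lower_semicontinuous g ->
  g x = gx%:E -> 0 < eps -> eps_subdiff g x eps !=set0.
Proof.
move=> gN cg lsg gxE e0; apply: contrapT => /nonemptyPn no.
have sub a : eps_subdiff g x eps a -> a (0 : X) <= -1 by rewrite no.
have [r [_]] := eps_subdiff_slope 0 gN cg lsg gxE e0 sub (ltrN10 R).
by rewrite scaler0 addr0 gxE lte_fin; lra.
Qed.

(** * Scaling, chords along rays, and upper semicontinuity on compact spaces *)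

Lemma econvex_scale (R : realType) (X : tvsType R) (g : X -> \bar R) (k : R) :
  (forall u, g u != -oo%E) -> 0 < k -> econvex g ->
  econvex (fun z => (k%:E * g z)%E).
Proof.
move=> gN k0 cg u v l l01; have /andP[l0 l1] := l01.
have ml (c : R) w : 0 <= c -> (c%:E * g w)%E != -oo%E.
  rewrite le_eqVlt => /predU1P[<-|c0]; first by rewrite mul0e.
  by have := gN w; case: (g w) => // _; rewrite gt0_muley// lte_fin.
rewrite !(muleCA _ k%:E) -muleDr//; last first.
  by rewrite /adde_def !(negPf (ml _ _ _)) ?subr_ge0// !andbF.
by apply: lee_wpmul2l; [rewrite lee_fin ltW|exact: cg].
Qed.

Lemma lower_semicontinuous_scale (R : realType) (X : topologicalType)
    (g : X -> \bar R) (k : R) :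
  0 < k -> lower_semicontinuous g -> lower_semicontinuous (fun z => (k%:E * g z)%E).
Proof.
move=> k0 lsg y a; rewrite -lte_pdivrMl// -EFinM => /lsg[V Vy Vg].
by exists V => // w /Vg; rewrite EFinM lte_pdivrMl.
Qed.

Lemma econvex_ray {R : realType} {X : tvsType R} {g : X -> \bar R} {x z : X} {p q r s : R} :
  econvex g -> (g x <= p%:E)%E -> (g (x + r *: z)%R <= q%:E)%E -> 0 < s <= r ->
  (g (x + s *: z)%R <= (p + s * ((q - p) / r))%:E)%E.
Proof.
move=> cg gp gq /andP[s0 sr]; have r0 := lt_le_trans s0 sr.
have l01 : 0 <= s / r <= 1.
  by apply/andP; split; [rewrite divr_ge0 ?ltW|rewrite ler_pdivrMr ?mul1r].
have := econvex_le cg gp gq l01.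
have -> : (1 - s / r) *: x + s / r *: (x + r *: z) = x + s *: z.
  by rewrite scalerDr scalerBl scale1r scalerA divfK ?gt_eqF// addrA subrK.
by have -> : (1 - s / r) * p + s / r * q = p + s * ((q - p) / r) by field; rewrite gt_eqF.
Qed.

(** Near each [t] some level below [b] bounds [h], and so does every level between it and [b];
    compactness gives a common one. *)
Lemma usc_compact_lt {R : realType} {T : topologicalType} {h : T -> \bar R} {b : R} :
  compact [set: T] -> upper_semicontinuous h -> (forall t, (h t < b%:E)%E) ->
  exists2 c, c < b & forall t, (h t <= c%:E)%E.
Proof.
move=> /compact_near_coveringP cT usc hb.
have H : \forall c \near b^'-, [set: T] `<=` (fun t => (h t <= c%:E)%E).
  apply: cT => t _.
  have [c [hc cb]] : exists c, (h t < c%:E)%E /\ c < b.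
    have := hb t; case: (h t) => [y| |] //.
      by rewrite lte_fin => yb; exists ((y + b) / 2); rewrite lte_fin; lra.
    by move=> _; exists (b - 1); rewrite ltNyr; split => //; lra.
  have [V Vt Vh] := usc _ _ hc.
  exists (V, [set c' | c <= c']); first by split => //=; exact: nbhs_left_ge.
  move=> [t' c'] /= [/Vh/ltW h1 h2]; apply: le_trans h1 _; by rewrite lee_fin.
have [c [cT' cb]] := filter_ex (filterI H (nbhs_left_lt b)).
by exists c => // t; exact: cT'.
Qed.

(** * Dual functionals and the weak* closed convex hull *)

Lemma dual_comb {R : realType} {X : tvsType R} {a b : X -> R} (k l : R) :
  dual a -> dual b -> dual (fun z => k * a z + l * b z).
Proof.
move=> [la ca] [lb cb]; split; first by move=> c u v; rewrite la lb; ring.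
move=> u; apply: (@cvgD R R^o); apply: (@cvgM R); try exact: cvg_cst.
  exact: ca.
exact: cb.
Qed.

Lemma dual_theta (R : realType) (X : tvsType R) : dual (@theta R X).
Proof.
split; first by move=> *; rewrite /theta mulr0 addr0.
by move=> u; exact: cvg_cst.
Qed.

Lemma convex_fset_dual (R : realType) (X : tvsType R) : convex_fset (@dual R X).
Proof. by move=> a b l da db _; exact: dual_comb. Qed.

Lemma wstar_clconv_dual (R : realType) (X : tvsType R) (A : set (X -> R)) xs :
  A `<=` dual -> wstar_clconv A xs -> dual xs.
Proof. by move=> Ad; apply => //; [exact: convex_fset_dual]. Qed.

(** The half-space of dual functionals at most [K] at [z] is convex and weak* closed, so it contains
    the hull. *)
Lemma wstar_clconv_le (R : realType) (X : tvsType R) (A : set (X -> R)) xs z K :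
  A `<=` dual -> (forall a, A a -> a z <= K) -> wstar_clconv A xs -> xs z <= K.
Proof.
move=> Ad AK Axs.
suff : (dual `&` [set a : X -> R | a z <= K]) xs by case.
apply: Axs.
- by move=> a [].
- move=> a b l [da aK] [db bK] l01; split; first exact: convex_fset_dual.
  have /andP[l0 l1] := l01; rewrite /= in aK bK *.
  have : (1 - l) * a z <= (1 - l) * K by rewrite ler_wpM2l// subr_ge0.
  have : l * b z <= l * K by rewrite ler_wpM2l.
  lra.
- move=> a da acl; split => //=; rewrite leNgt; apply/negP => Ka.
  have e0 : 0 < a z - K by rewrite subr_gt0.
  have [b [_ /= bK] /(_ z)] := acl [:: z] _ e0.
  rewrite mem_head => /(_ isT); rewrite ltr_norml => /andP[h1 h2]; lra.
- by move=> a Aa; split; [exact: Ad|exact: AK].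
Qed.

(** * The subdifferential of the supremum *)

Definition inactive_part {R : realType} {X : tvsType R} {T : Type}
    (ft : T -> X -> \bar R) (rho : T -> R) (x : X) (eps : R) : set (X -> R) :=
  if `[< active ft x = [set: T] >] then [set theta]
  else \bigcup_(t in ~` active ft x)
         fun_mscale [set 0; eps]
           (eps_subdiff (fun z => ((rho t)%:E * ft t z)%E) x eps).

Definition generators {R : realType} {X : tvsType R} {T : Type}
    (ft : T -> X -> \bar R) (rho : T -> R) (x : X) (eps : R) : set (X -> R) :=
  fun_msum (\bigcup_(t in active ft x) eps_subdiff (ft t) x eps)
    (inactive_part ft rho x eps).

Section supremum.
Context {R : realType} {X : tvsType R} {T : topologicalType}.
Context {ft : T -> X -> \bar R} {rho : T -> R} {x : X} {fx : R}.
Hypothesis fN : forall t u, ft t u != -oo%E.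
Hypothesis cf : forall t, econvex (ft t).
Hypothesis lscf : forall t, lower_semicontinuous (ft t).
Hypothesis cT : compact [set: T].
Hypothesis uscf : forall z, upper_semicontinuous (fun t => ft t z).
Hypothesis fxE : supf ft x = fx%:E.
Hypothesis rho01 : forall t, 0 < rho t <= 1.

Let rho0 t : 0 < rho t. Proof. by case/andP: (rho01 t). Qed.

Lemma le_supf t y : (ft t y <= supf ft y)%E.
Proof. by apply: ereal_sup_ubound; exists t. Qed.

Lemma ft_fin t : exists p, ft t x = p%:E.
Proof.
have := le_supf t x; have := fN t x; rewrite fxE.
by case: (ft t x) => // p _ _; exists p.
Qed.

(** Otherwise compactness would give one level below [fx] bounding all [ft t x], hence their
    supremum. *)
Lemma active_nonempty : active ft x !=set0.
Proof.
apply: contrapT => /nonemptyPn no.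
have lt t : (ft t x < fx%:E)%E.
  rewrite lt_neqAle -{2}fxE le_supf andbT; apply/negP => /eqP tx.
  by have : active ft x t; [rewrite /active/= fxE|rewrite no].
have [c cfx fc] := usc_compact_lt cT (uscf x) lt.
have : (supf ft x <= c%:E)%E by apply: ge_ereal_sup => _ [t _ <-].
by rewrite fxE lee_fin leNgt cfx.
Qed.

Local Notation inactives := (inactive_part ft rho x).
Local Notation gens := (generators ft rho x).

Lemma scaled_subdiff_nonempty t {eps} : 0 < eps ->
  eps_subdiff (fun z => ((rho t)%:E * ft t z)%E) x eps !=set0.
Proof.
move=> e0; have [p pE] := ft_fin t.
apply: (eps_subdiff_nonempty (gx := rho t * p)) => //.
- by move=> u; have := fN t u; case: (ft t u) => // _; rewrite gt0_muley ?lte_fin.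
- exact: econvex_scale.
- exact: lower_semicontinuous_scale.
- by rewrite pE.
Qed.

(** When some index is inactive, [theta] is 0 times an eps-subgradient, so one must exist. *)
Lemma inactives_theta eps : 0 < eps -> inactives eps theta.
Proof.
move=> e0; rewrite /inactive_part; case: asboolP => // aT.
have [t nt] : exists t, ~ active ft x t.
  by apply/existsNP => H; apply: aT; apply/seteqP; split.
have [a ha] := scaled_subdiff_nonempty t e0.
exists t => //; exists 0, a; split => //; first by left.
by apply/funext => z; rewrite mul0r.
Qed.

Lemma gens_dual eps : gens eps `<=` dual.
Proof.
move=> _ [a [b [[t _ [da _ _]] hb ->]]].
have db : dual b.
  move: hb; rewrite /inactive_part; case: asboolP => _.
    by move=> ->; exact: dual_theta.
  move=> [t' _ [l [c [_ [dc _ _] ->]]]].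
  have := dual_comb l 0 dc dc; congr dual.
  by apply/funext => z; rewrite mul0r addr0.
have := dual_comb 1 1 da db; congr dual.
by apply/funext => z; rewrite !mul1r.
Qed.

(** The active summand gives [fy - fx + eps]. The inactive one is zero or carries a factor [eps], so
    a bound uniform in [t] suffices: [rho t <= 1] controls the value at [y], and [M] the one at
    [x]. *)
Lemma gens_le eps M y fy a : 0 < eps ->
  (forall t, (M%:E <= (rho t)%:E * ft t x)%E) -> supf ft y = fy%:E ->
  gens eps a -> a (y - x) <= fy - fx + eps * (1 + `|fy| + `|M| + eps).
Proof.
move=> e0 hM fyE [b [c [[t tA [_ _ /(_ y) hb]] hc ->]]].
have h1 : b (y - x) <= fy - fx + eps.
  have := le_trans hb (le_supf t y); rewrite fyE tA fxE lee_fin; lra.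
suff h2 : c (y - x) <= eps * (`|fy| + `|M| + eps) by lra.
have P0 : 0 <= eps * (`|fy| + `|M| + eps) by rewrite mulr_ge0 ?addr_ge0// ltW.
move: hc; rewrite /inactive_part; case: asboolP => _; first by move=> ->.
move=> [t' _ [l [d [hl [_ _ /(_ y) hd] ->]]]]; case: hl => ->; first by rewrite mul0r.
rewrite ler_pM2l//.
have [p pE] := ft_fin t'; have := hM t'; rewrite pE lee_fin => Mp.
have : ((rho t')%:E * ft t' y <= (rho t' * fy)%:E)%E.
  by rewrite EFinM -fyE; apply: lee_wpmul2l; [rewrite lee_fin ltW|exact: le_supf].
move=> /(le_trans hd); rewrite pE lee_fin => hh.
have : rho t' * fy <= `|fy|.
  apply: le_trans (ler_norm _) _; rewrite normrM gtr0_norm//.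
  by rewrite ler_piMl//; case/andP: (rho01 t').
have : - M <= `|M| by rewrite -normrN ler_norm.
lra.
Qed.

Lemma supf_near_ray {xs : R} {z eps d} (t0 : T) : 0 < eps -> 0 < d ->
  (forall a, gens eps a -> a z <= xs - d) ->
  \forall t \near t0 & s \near (0 : R)^'+,
    (ft t (x + s *: z)%R <= (fx + s * (xs - d / 2))%:E)%E.
Proof.
move=> e0 d0 az; set m := xs - d / 2.
have dm : xs - d < m by rewrite /m; lra.
have fxle t : (ft t x <= fx%:E)%E by rewrite -fxE le_supf.
have [p0 p0E] := ft_fin t0.
have [t0A|t0I] := pselect (active ft x t0).
  have E0 : ft t0 x = fx%:E by rewrite -fxE.
  have sub a : eps_subdiff (ft t0) x eps a -> a z <= xs - d.
    move=> ha; apply: az; exists a, theta; split; [by exists t0|exact: inactives_theta|].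
    by apply/funext => u; rewrite /theta addr0.
  have [r [r0 hr]] := eps_subdiff_slope _ (fN t0) (cf t0) (lscf t0) E0 e0 sub dm.
  have [V Vt Vh] := uscf _ _ _ hr.
  exists (V, [set s | 0 < s <= r]).
    split => //=; near=> s; apply/andP; split; near: s.
      exact: nbhs_right_gt.
    exact: nbhs_right_le.
  move=> [t s] /= [/Vh/ltW ht sr].
  (* The chord has slope [(r * m - eps) / r], which is at most [m]. *)
  apply: le_trans (econvex_ray (cf t) (fxle t) ht sr) _.
  have /andP[s0 _] := sr.
  rewrite lee_fin lerD2l ler_pM2l// ler_pdivrMr//; lra.
(* Fixing an active summand [a1] turns the bound on generators [a1 + eps a] into a bound on [a z],
   possibly large. *)
have [t1 t1A] := active_nonempty.
have [p1 p1E] := ft_fin t1.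
have [a1 ha1] : eps_subdiff (ft t1) x eps !=set0.
  exact: (eps_subdiff_nonempty (gx := p1)).
have sub a : eps_subdiff (fun z => ((rho t0)%:E * ft t0 z)%E) x eps a ->
    a z <= (xs - d - a1 z) / eps.
  move=> ha; have : a1 z + eps * a z <= xs - d.
    apply: (az (fun u => a1 u + eps * a u)); exists a1, (fun u => eps * a u); split => //.
      by exists t1.
    rewrite /inactive_part; case: asboolP => [aT|_]; first by exfalso; apply: t0I; rewrite aT.
    by exists t0 => //; exists eps, a; split => //; right.
  by rewrite ler_pdivlMr// mulrC; lra.
have [r [r0 hr]] : exists r, 0 < r /\ ((rho t0)%:E * ft t0 (x + r *: z)%R < +oo)%E.
  have [||||r [r0 hr]] := eps_subdiff_slope z (gx := rho t0 * p0) _ _ _ _ e0 sub (ltr_pwDr ltr01 (lexx _)).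
  - by move=> u; have := fN t0 u; case: (ft t0 u) => // _; rewrite gt0_muley ?lte_fin.
  - exact: econvex_scale.
  - exact: lower_semicontinuous_scale.
  - by rewrite p0E.
  - by exists r; split => //; apply: lt_trans hr (ltry _).
have [K hK] : exists K : R, (ft t0 (x + r *: z)%R < K%:E)%E.
  move: hr; have := fN t0 (x + r *: z); case: (ft t0 _) => [y| |]// _.
    by exists (y + 1); rewrite lte_fin; lra.
  by rewrite gt0_muley ?lte_fin.
have p0x : p0 < fx.
  rewrite lt_neqAle -lee_fin -p0E -fxE le_supf andbT; apply/negP => /eqP pp.
  by apply: t0I; rewrite /active/= p0E fxE pp.
(* Near [t0] the values at [x] stay below [c]; the gap [fx - c] pays for the steep chord up to [K]
   when [s] is small. *)
pose c := (p0 + fx) / 2.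
have cx : c < fx by rewrite /c; lra.
have hc : (ft t0 x < c%:E)%E by rewrite p0E lte_fin /c; lra.
have [V1 V1t V1h] := uscf _ _ _ hK; have [V2 V2t V2h] := uscf _ _ _ hc.
(* A positive bound for the excess slope: [s * q <= fx - c] keeps the chord below the target
   line. *)
pose q := `|(K - c) / r - m| + 1.
have q0 : 0 < q by rewrite /q ltr_wpDl.
exists (V1 `&` V2, [set s | 0 < s <= r /\ s <= (fx - c) / q]).
  split => /=; first exact: filterI.
  near=> s; split; [apply/andP; split|]; near: s.
  - exact: nbhs_right_gt.
  - exact: nbhs_right_le.
  - by apply: nbhs_right_le; rewrite divr_gt0// subr_gt0.
move=> [t s] /= [[/V1h/ltW h1 /V2h/ltW h2] [sr sq]].
apply: le_trans (econvex_ray (cf t) h2 h1 sr) _.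
have /andP[s0 _] := sr; rewrite ler_pdivlMr// in sq.
have : s * ((K - c) / r - m) <= s * q.
  rewrite ler_pM2l// /q; have := ler_norm ((K - c) / r - m); lra.
by rewrite lee_fin mulrBr; lra.
Unshelve. all: by end_near. Qed.

Lemma subdiff_supf_sub xs eps : 0 < eps -> subdiff (supf ft) x xs ->
  wstar_clconv (gens eps) xs.
Proof.
move=> e0 [dxs _ subxs] C Cd cC wC AC; apply: contrapT => nC.
have [a0 Ca0] : C !=set0.
  have [t1 t1A] := active_nonempty; have [p1 p1E] := ft_fin t1.
  have [a1 ha1] := eps_subdiff_nonempty (fN t1) (cf t1) (lscf t1) p1E e0.
  exists (fun u => a1 u + theta u); apply: AC; exists a1, theta; split => //.
    by exists t1.
  exact: inactives_theta.
have [|z [d [d0 Cz]]] := wstar_separation (ex_intro _ _ Ca0) Cd cC dxs.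
  by move=> /(wC _ dxs).
have az a : gens eps a -> a z <= xs z - d by move=> /AC; exact: Cz.
(* Compactness of [T] turns the local thresholds on [s] into one [s > 0] valid for all [t]. *)
have /compact_near_coveringP cT' := cT.
have /= H := cT' _ ((0 : R)^'+) (fun s t => (ft t (x + s *: z)%R <= (fx + s * (xs z - d / 2))%:E)%E) (at_right_proper_filter (0 : R))
  (fun t _ => supf_near_ray t e0 d0 az).
have [s [sT s0]] := @filter_ex _ _ (at_right_proper_filter (0 : R)) _ (filterI H (nbhs_right_gt (0 : R))).
have : (supf ft (x + s *: z)%R <= (fx + s * (xs z - d / 2))%:E)%E.
  by apply: ge_ereal_sup => _ [t _ <-]; exact: sT.
have [lxs _] := dxs.
have xz : x + s *: z - x = s *: z by rewrite addrAC subrr add0r.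
move=> /(le_trans (subxs _)); rewrite fxE xz (is_linearZ lxs) lee_fin.
have : 0 < s * d by rewrite mulr_gt0.
lra.
Qed.

Lemma clconv_sub_subdiff_supf xs :
  (exists M : R, forall t, (M%:E <= (rho t)%:E * ft t x)%E) ->
  (forall eps, 0 < eps -> wstar_clconv (gens eps) xs) -> subdiff (supf ft) x xs.
Proof.
move=> [M hM] H; split; [exact: wstar_clconv_dual (gens_dual 1) (H _ ltr01)|by rewrite fxE|].
move=> y; have [t _] := active_nonempty.
have := fN t y; have := le_supf t y; case fyE : (supf ft y) => [fy| |]; last 2 first.
- by move=> _ _; rewrite leey.
- by rewrite leeNy_eq => /eqP ->.
move=> _ _; rewrite fxE lee_fin subr0.
have le eps : 0 < eps -> xs (y - x) <= fy - fx + eps * (1 + `|fy| + `|M| + eps).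
  move=> e0; apply: wstar_clconv_le (gens_dual eps) _ (H _ e0) => a.
  exact: gens_le.
suff : xs (y - x) <= fy - fx by lra.
rewrite leNgt; apply/negP => lt.
pose dl := xs (y - x) - (fy - fx); pose P := 2 + `|fy| + `|M|.
have dl0 : 0 < dl by rewrite /dl; lra.
have P0 : 0 < P by rewrite /P; have := normr_ge0 fy; have := normr_ge0 M; lra.
(* Since [e <= 1], the error term is at most [e * P = dl - e * dl], strictly less than the assumed
   excess [dl]. *)
pose e := dl / (P + dl).
have e0 : 0 < e by rewrite divr_gt0// addr_gt0.
have e1 : e <= 1 by rewrite /e ler_pdivrMr; [rewrite mul1r lerDr ltW|exact: addr_gt0].
have eE : e * (P + dl) = dl by rewrite divfK// gt_eqF// addr_gt0.
have ed : 0 < e * dl by rewrite mulr_gt0.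
have ee : e * e <= e by rewrite ler_piMr// ltW.
have := le _ e0; rewrite /P /dl in eE ed; lra.
Qed.

Lemma subdiff_supf :
  (exists M : R, forall t, (M%:E <= (rho t)%:E * ft t x)%E) ->
  subdiff (supf ft) x = [set xs | forall eps, 0 < eps -> wstar_clconv (gens eps) xs].
Proof.
move=> hM; apply/seteqP; split => xs /= H; last exact: clconv_sub_subdiff_supf.
by move=> eps e0; exact: subdiff_supf_sub.
Qed.

End supremum.

Theorem theorem3 (R : realType) (X : tvsType R) (T : topologicalType)
  (ft : T -> X -> \bar R) (rho : T -> R) (x : X) :
  hausdorff_space X ->
  inhabited T ->
  (forall t, proper_fun (ft t) /\ econvex (ft t) /\ lower_semicontinuous (ft t)) ->
  (* (SH) *)
  compact [set: T] -> hausdorff_space T ->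
  (forall z, upper_semicontinuous (fun t => ft t z)) ->
  (supf ft x < +oo)%E ->
  (forall t, 0 < rho t <= 1) ->
  (exists M : R, forall t, (M%:E <= (rho t)%:E * ft t x)%E) ->
  subdiff (supf ft) x =
  [set xs | forall eps : R, 0 < eps ->
     wstar_clconv
       (fun_msum (\bigcup_(t in active ft x) eps_subdiff (ft t) x eps)
             (if `[< active ft x = [set: T] >] then [set theta]
              else \bigcup_(t in ~` active ft x)
                     fun_mscale [set 0; eps]
                       (eps_subdiff (fun z => ((rho t)%:E * ft t z)%E) x eps)))
       xs].
Proof.
move=> _ [t0] hf cT _ usc fxoo rho01 hM.
(* The value at an index [t0] excludes -oo. *)
have [fx fxE] : exists fx, supf ft x = fx%:E.
  have := (hf t0).1.1 x; have := @le_supf _ _ _ ft t0 x; move: fxoo.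
  case: (supf ft x) => [p| |]// _; first by exists p.
  by rewrite leeNy_eq => /eqP ->.
apply: (@subdiff_supf R X T ft rho x fx) => // t; last exact: (hf t).2.2.
  exact: (hf t).1.1.
exact: (hf t).2.1.
Qed.
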